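(* Let $G=(V,E)$ be a connected graph with chromatic number $2$, let $\emptyset\ne V_c\subsetneq V$, and let $g:V_c\to\{0,1\}$ be such that no two adjacent vertices of $V_c$ have the same value under $g$. Let $f$ be a maximum contrast greyscale for the $\{0,1\}$-restricted maximum contrast problem on $G$ with initial colouring $g$. Then $\mathrm{Im}(f)\subseteq\{0,\frac13,\frac12,\frac23,1\}$.
   Context: Graphs are finite, undirected and simple. A greyscale of $G=(V,E)$ is a map $f:V\to[0,1]$ with $0,1\in \mathrm{Im}(f)$. For $e=\{u,v\}\in E$ put $\widehat f(e)=|f(u)-f(v)|$. The contrast vector $\mathcal C_f$ is the vector of all values $\widehat f(e)$, $e\in E$, listed in ascending order; contrast vectors are compared lexicographically. A greyscale $f$ is compatible with $g$ if $f(u)=g(u)$ for all $u\in V_c$. A maximum contrast greyscale for the $\{0,1\}$-restricted maximum contrast problem ($\{0,1\}$-RMACG) with data $(G,V_c,g)$ is a greyscale compatible with $g$ whose contrast vector is the lexicographic maximum among all greyscales of $G$ compatible with $g$. *)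

(* Defs.v *)
From HB Require Import structures.
From mathcomp Require Import all_boot all_order all_algebra.
From mathcomp Require Import reals.

Set Implicit Arguments.
Unset Strict Implicit.
Unset Printing Implicit Defensive.

Import Order.TTheory GRing.Theory Num.Theory.
Local Open Scope ring_scope.

Record sgraph (V : finType) := SGraph {
  adj :> rel V;
  adj_sym : symmetric adj;
  adj_irr : irreflexive adj }.

Section Graphs.
Variables (V : finType) (G : sgraph V).

Definition connected_graph : Prop := forall u v : V, connect G u v.

Definition colorable (k : nat) : bool :=
  [exists c : {ffun V -> 'I_k}, [forall u, forall v, G u v ==> (c u != c v)]].

Lemma colorable_ex : exists k, colorable k.
Proof.
exists #|V|; apply/existsP; exists [ffun v => enum_rank v].
apply/forallP => u; apply/forallP => v; apply/implyP => uv.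
rewrite !ffunE (inj_eq enum_rank_inj).
by apply: contraTneq uv => ->; rewrite adj_irr.
Qed.

Definition chromatic_number : nat := ex_minn colorable_ex.

Definition edges : {set {set V}} :=
  [set [set p.1; p.2] | p : V * V & G p.1 p.2].

End Graphs.

Section Contrast.
Variables (R : realType) (V : finType).

Definition greyscale (f : V -> R) : Prop :=
  [/\ forall v, 0 <= f v <= 1, exists v, f v = 0 & exists v, f v = 1].

(* The choice of the endpoints u, v of A = {u, v} is immaterial, see           *)
(* edge_contrastE; the default 0 is never used on an edge.                     *)
Definition edge_contrast (f : V -> R) (A : {set V}) : R :=
  if [pick p : V * V | A == [set p.1; p.2]] is Some p
  then `|f p.1 - f p.2| else 0.

Lemma edge_contrastE (f : V -> R) (u v : V) :
  edge_contrast f [set u; v] = `|f u - f v|.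
Proof.
rewrite /edge_contrast; case: pickP => [[a b] /= /eqP E|/(_ (u, v))]; last first.
  by rewrite eqxx.
have /set2P[]: a \in [set u; v] by rewrite E set21.
  move=> ?; subst a; have /set2P[]: b \in [set u; v] by rewrite E set22.
    move=> ?; subst b; have: v \in [set u; u] by rewrite -E set22.
    by case/set2P=> ->.
  by move=> ->.
move=> ?; subst a; have /set2P[]: b \in [set u; v] by rewrite E set22.
  by move=> ->; rewrite distrC.
move=> ?; subst b; have: u \in [set v; v] by rewrite -E set21.
by case/set2P=> ->.
Qed.

(* seqlexi R is seq R with its lexicographic order.                            *)
Definition contrast_vector (G : sgraph V) (f : V -> R) : seqlexi R :=
  sort <=%R [seq edge_contrast f A | A <- enum (edges G)].

(* Only the values of g on Vc matter.                                          *)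
Definition compatible (Vc : {set V}) (g f : V -> R) : Prop :=
  {in Vc, forall u, f u = g u}.

Definition max_contrast_greyscale
    (G : sgraph V) (Vc : {set V}) (g f : V -> R) : Prop :=
  [/\ greyscale f, compatible Vc g f &
      forall h : V -> R, greyscale h -> compatible Vc g h ->
        (contrast_vector G h <= contrast_vector G f)%O].

End Contrast.

(* Main.v *)
Require Import Defs.
From HB Require Import structures.
From mathcomp Require Import all_boot all_order all_algebra.
From mathcomp Require Import reals.
From mathcomp Require Import lra.

Set Implicit Arguments.
Unset Strict Implicit.
Unset Printing Implicit Defensive.

Import Order.TTheory GRing.Theory Num.Theory.
Local Open Scope ring_scope.

(** A 2-colouring [c] of [G] yields a compatible greyscale all of whose
    contrasts are at least 1/3: give the uncoloured vertices the values 1/3 and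
    2/3 according to [c].  Hence every contrast of [f] is at least 1/3.
    A vertex [v] with [0 < f v < 1] is not in [Vc] and has neighbours both
    below and above it, since otherwise moving it to 0 or 1 would increase all
    contrasts at [v].  If a neighbour [w] of [v] also has [0 < f w < 1], there
    is an ascending path of three edges through [v] and [w], and its values
    must be 0, 1/3, 2/3, 1.  Otherwise all neighbours of [v] have value 0 or 1,
    both occurring, and moving [v] to 1/2 shows that [f v = 1/2]. *)

(** * Lexicographic comparison of sorted sequences *)

Lemma lexi_lt_split d (T : orderType d) (r s : seqlexi T) :
  size r = size s -> (r < s)%O ->
  exists p a b r' s', [/\ r = p ++ a :: r', s = p ++ b :: s' & (a < b)%O].
Proof.
elim: r s => [|a r IH] [|b s] //= [Esz].
rewrite Order.SeqLexiOrder.Exports.ltxi_cons; case: (ltgtP a b) => //= [ab _|<-].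
  by exists [::], a, b, r, s.
by move=> /(IH _ Esz)[p [x [y [r' [s' [-> -> xy]]]]]]; exists (a :: p), x, y, r', s'.
Qed.

Lemma count_split (T : eqType) (a1 a2 : pred T) (s : seq T) :
  {in s, forall x, a1 x -> a2 x} ->
  count a2 s = (count a1 s + count (predI (predC a1) a2) s)%N.
Proof.
move=> a12; rewrite -size_filter -(count_predC a1) !count_filter; congr addn.
by apply: eq_in_count => x /a12 /=; case: (a1 x) => // ->.
Qed.

Lemma sort_lexi_lt (R : realDomainType) (T : eqType) (F H : T -> R) (t : R)
    (es : seq T) (e0 : T) :
  {in es, forall e, Num.min (F e) t <= H e} ->
  e0 \in es -> F e0 < t -> F e0 < H e0 ->
  ((sort <=%R (map F es) : seqlexi R) < (sort <=%R (map H es) : seqlexi R))%O.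
Proof.
move=> FH e0s Ft FHe; rewrite ltNge; apply/negP.
set r := (X in (X <= _)%O); set s := (X in (_ <= X)%O) => rs.
(* For [x < t] at most as many entries of [r] as of [s] are [<= x], strictly
   fewer if [x = F e0]; so [r] cannot have the smaller entry [a] at the first
   difference, neither with [a < t] (take [x = a]) nor with [a >= t] (take
   [x = F e0]). *)
have cntE (K : T -> R) x :
    count (<= x) (sort <=%R (map K es)) = count (fun e => K e <= x) es.
  by rewrite count_sort count_map; apply: eq_count.
have leHF x : x < t -> {in es, forall e, H e <= x -> F e <= x}.
  move=> xt e /FH; rewrite ge_min => /orP[FeH Hx|tH Hx]; first exact: le_trans Hx.
  by have := lt_le_trans xt (le_trans tH Hx); rewrite ltxx.
have cnt_le x : x < t -> (count (<= x) r <= count (<= x) s)%N.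
  by move=> xt; rewrite !cntE (count_split (leHF x xt)) leq_addr.
have cnt_neq : count (<= F e0) r <> count (<= F e0) s.
  rewrite !cntE (count_split (leHF _ Ft)) => /eqP.
  rewrite -[X in X == _]addn0 eqn_add2l eq_sym -leqn0 leqNgt -has_count => /negP.
  by apply; apply/hasP; exists e0 => //=; rewrite -ltNge FHe lexx.
have sz : size r = size s by rewrite !size_sort !size_map.
move: rs; rewrite le_eqVlt => /orP[/eqP rs|]; first by rewrite rs in cnt_neq.
case/(lexi_lt_split sz) => p [a [b [r' [s' [rE sE ab]]]]].
(* This reduces a count of entries [<= x] to the common prefix [p] whenever [x] is below the entry
   at the first difference. *)
have count_tail (p1 p2 : seq R) x y :
    sorted <=%R (p1 ++ y :: p2) -> x < y -> count (<= x) (y :: p2) = 0%N.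
  move=> /cat_sorted2[_]; rewrite [sorted _ _](path_sortedE le_trans) => /andP[yp2 _] xy.
  apply/eqP; rewrite -[_ == _]negbK -lt0n -has_count; apply/hasPn => z.
  rewrite inE -ltNge => /predU1P[->//|zp2]; apply: lt_le_trans xy _.
  exact: (allP yp2).
have sr : sorted <=%R (p ++ a :: r') by rewrite -rE; exact: sort_le_sorted.
have ss : sorted <=%R (p ++ b :: s') by rewrite -sE; exact: sort_le_sorted.
have [ta|a_lt_t] := leP t a; last first.
  have := cnt_le a a_lt_t; rewrite rE sE !count_cat (count_tail _ _ _ _ ss ab).
  by rewrite leq_add2l /= lexx.
apply: cnt_neq; rewrite rE sE !count_cat (count_tail _ _ _ _ sr (lt_le_trans Ft ta)).
by rewrite (count_tail _ _ _ _ ss (lt_trans (lt_le_trans Ft ta) ab)).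
Qed.

(** Contrasts of at least [t] may drop as long as they stay at least [t]: in ascending order, a
    strict gain below [t] decides the comparison before they matter. *)
Lemma max_contrast_leximin (R : realType) (V : finType) (G : sgraph V)
    (Vc : {set V}) (g f h : V -> R) (t : R) :
  max_contrast_greyscale G Vc g f -> greyscale h -> compatible Vc g h ->
  (forall u v, G u v -> Num.min `|f u - f v| t <= `|h u - h v|) ->
  forall u v, G u v -> `|f u - f v| < t -> `|h u - h v| <= `|f u - f v|.
Proof.
move=> [_ _ fmax] hgs hg fh u v uv fuv; rewrite leNgt; apply/negP => huv.
have := fmax h hgs hg; rewrite leNgt => /negP; apply.
apply: (@sort_lexi_lt _ _ _ _ t _ [set u; v]); rewrite ?edge_contrastE //.
  move=> A; rewrite mem_enum => /imsetP[p /[!inE] Gp ->].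
  by rewrite !edge_contrastE fh.
by rewrite mem_enum; apply/imsetP; exists (u, v); rewrite ?inE.
Qed.

(** * A compatible greyscale with large contrasts *)

Lemma chromatic_number2_coloring (V : finType) (G : sgraph V) :
  chromatic_number G = 2%N -> exists c : V -> bool, forall u v, G u v -> c u != c v.
Proof.
rewrite /chromatic_number; case: ex_minnP => k /existsP[c cP] _ k2; subst k.
exists (fun v => c v == ord0) => u v uv.
have /implyP/(_ uv) := forallP (forallP cP u) v.
by move: (c u) (c v) => [[|[|//]] ?] [[|[|//]] ?].
Qed.

(** A greyscale must attain both 0 and 1, but [g] may be constant on [Vc]. In that case one vertex
    outside [Vc] receives the other value, which cannot clash with any neighbour in [Vc]. *)
Lemma extend_coloring (R : realType) (V : finType) (G : sgraph V) (Vc : {set V})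
    (g : V -> R) :
  Vc != set0 -> Vc \proper [set: V] ->
  {in Vc, forall v, g v = 0 \/ g v = 1} ->
  {in Vc &, forall u v, G u v -> g u <> g v} ->
  exists (S : {set V}) (g' : V -> R),
    [/\ Vc \subset S, compatible Vc g g', {in S, forall v, g' v = 0 \/ g' v = 1},
        {in S &, forall u v, G u v -> g' u <> g' v} &
        exists y z, [/\ y \in S, z \in S, g' y = 0 & g' z = 1]].
Proof.
move=> /set0Pn[z zVc] /properP[_ [p _ pVc]] g01 gG.
have [/existsP[y /andP[yVc gyz]]|/existsPn gz] :=
  boolP [exists y, (y \in Vc) && (g y != g z)].
  exists Vc, g; split => //.
  case: (g01 y yVc) (g01 z zVc) gyz => [] gy [] gz; rewrite gy gz ?eqxx // => _.
    by exists y, z.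
  by exists z, y.
have gzE u : u \in Vc -> g u = g z.
  by move=> uVc; have := gz u; rewrite uVc negbK => /eqP.
pose g' v := if v == p then 1 - g z else g v.
have g'E u : u \in Vc -> g' u = g u.
  by rewrite /g'; case: eqP => // ->; rewrite (negbTE pVc).
have g'p : g' p = 1 - g z by rewrite /g' eqxx.
have zp : 1 - g z <> g z by case: (g01 z zVc) => ->; lra.
exists (p |: Vc), g'; split.
- exact: subsetUr.
- exact: g'E.
- move=> v /setU1P[->|vVc]; last by rewrite g'E //; exact: g01.
  by rewrite g'p; case: (g01 z zVc) => ->; [right|left]; lra.
- move=> u v /setU1P[->|uVc] /setU1P[->|vVc].
  + by rewrite adj_irr.
  + by rewrite g'p g'E // gzE.
  + by rewrite g'p g'E // gzE // => _ /esym.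
  + by rewrite !g'E //; exact: gG.
have pS : p \in p |: Vc by rewrite setU11.
have zS : z \in p |: Vc by rewrite setU1r.
case: (g01 z zVc) => gzv.
  by exists z, p; rewrite g'p g'E // gzv subr0.
by exists p, z; rewrite g'p g'E // gzv subrr.
Qed.

Lemma exists_third_contrast (R : realType) (V : finType) (G : sgraph V)
    (Vc : {set V}) (g : V -> R) :
  chromatic_number G = 2%N -> Vc != set0 -> Vc \proper [set: V] ->
  {in Vc, forall v, g v = 0 \/ g v = 1} ->
  {in Vc &, forall u v, G u v -> g u <> g v} ->
  exists h : V -> R, [/\ greyscale h, compatible Vc g h &
    forall u v, G u v -> 1 / 3 <= `|h u - h v|].
Proof.
move=> /chromatic_number2_coloring[c cG] Vc0 VcT g01 gG.
have [S [g' [VcS g'g g'01 g'G [y [z [yS zS y0 z1]]]]]] :=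
  extend_coloring Vc0 VcT g01 gG.
pose h v : R := if v \in S then g' v else if c v then 1 / 3 else 2 / 3.
exists h; split.
- split; [move=> v|by exists y; rewrite /h yS|by exists z; rewrite /h zS].
  rewrite /h; case: ifPn => [/g'01[]->|_]; first lra; first lra.
  by case: (c v); lra.
- by move=> u uVc; rewrite /h (subsetP VcS) //; exact: g'g.
move=> u v uv; rewrite ler_normr /h.
case: (boolP (u \in S)) (boolP (v \in S)) => [] uS [] vS.
- have := g'G u v uS vS uv.
  by case: (g'01 u uS) (g'01 v vS) => -> [] -> // _; apply/orP; (left; lra) || (right; lra).
- by case: (g'01 u uS) (c v) => -> []; apply/orP; (left; lra) || (right; lra).
- by case: (g'01 v vS) (c u) => -> []; apply/orP; (left; lra) || (right; lra).
by case: (c u) (c v) (cG u v uv) => [] [] // _; apply/orP; (left; lra) || (right; lra).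
Qed.

(** * Moving a single vertex *)

Lemma connected_neighbor (V : finType) (G : sgraph V) (v z : V) :
  connected_graph G -> v != z -> exists w, G v w.
Proof.
move=> /(_ v z)/connectP[[|w p] /= Gp ->]; first by rewrite eqxx.
by move=> _; exists w; case/andP: Gp.
Qed.

(** As [f v] is neither 0 nor 1, [v] lies outside [Vc] and other vertices attain 0 and 1; so
    changing the value at [v] keeps a compatible greyscale and affects only the edges at [v]. *)
Lemma max_contrast_move (R : realType) (V : finType) (G : sgraph V)
    (Vc : {set V}) (g f : V -> R) (v : V) (a t : R) :
  {in Vc, forall v, g v = 0 \/ g v = 1} -> max_contrast_greyscale G Vc g f ->
  0 < f v < 1 -> 0 <= a <= 1 ->
  (forall w, G v w -> Num.min `|f v - f w| t <= `|a - f w|) ->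
  forall w, G v w -> `|f v - f w| < t -> `|a - f w| <= `|f v - f w|.
Proof.
move=> g01 fmax /andP[fv0 fv1] a01 fa w vw fvw.
have [[f01 [y y0] [z z1]] fg _] := fmax.
pose h u := if u == v then a else f u.
have hv : h v = a by rewrite /h eqxx.
have hN u : u != v -> h u = f u by rewrite /h => /negbTE->.
have Nv u : G v u -> u != v by apply: contraTneq => ->; rewrite adj_irr.
have := @max_contrast_leximin _ _ _ _ _ _ h t fmax _ _ _ v w vw fvw.
rewrite hv hN ?Nv //; apply.
- split; first by move=> u; rewrite /h; case: eqP.
    by exists y; rewrite hN //; apply: contraTneq fv0 => <-; rewrite y0 ltxx.
  by exists z; rewrite hN //; apply: contraTneq fv1 => <-; rewrite z1 ltxx.
- move=> u uVc; rewrite hN ?fg //; apply: contraTneq uVc => ->.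
  by apply/negP => vVc; case: (g01 v vVc) (fg v vVc) => -> ?; lra.
move=> u1 u2 u12; have [u1v|u1v] := eqVneq u1 v.
  by subst u1; rewrite hv hN ?Nv // fa.
have [u2v|u2v] := eqVneq u2 v; last by rewrite !hN // ge_min lexx.
by subst u2; rewrite hv hN // distrC [`|_ - a|]distrC fa // adj_sym.
Qed.

Lemma max_contrast_between (R : realType) (V : finType) (G : sgraph V)
    (Vc : {set V}) (g f : V -> R) (v : V) :
  connected_graph G -> {in Vc, forall v, g v = 0 \/ g v = 1} ->
  max_contrast_greyscale G Vc g f -> 0 < f v < 1 ->
  (exists2 w, G v w & f w < f v) /\ (exists2 w, G v w & f v < f w).
Proof.
move=> Gconn g01 fmax fv; have [[f01 [y y0] _] _ _] := fmax.
have [w vw] : exists w, G v w.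
  by apply: (connected_neighbor (z := y)) => //; apply: contraTneq fv => ->; rewrite y0 ltxx.
(* The threshold 2 exceeds every contrast, so the condition with the minimum becomes that no
   contrast at [v] decreases. *)
have far u : `|f v - f u| < 2.
  by have := f01 u; rewrite ltr_norml; lra.
split.
- have [/existsP[u /andP[]]|/existsPn low] := boolP [exists u, G v u && (f u < f v)].
    by exists u.
  have ge u : G v u -> f v <= f u by move=> vu; have := low u; rewrite vu -leNgt.
  have := @max_contrast_move _ _ _ _ _ _ v 0 2 g01 fmax fv _ _ w vw (far w).
  have := ge w vw; rewrite sub0r normrN => vw_le.
  rewrite ger0_norm ?[`|f v - _|]ler0_norm; [|lra|lra].
  move=> H; suff: f w <= - (f v - f w) by lra.
  apply: H; first by lra.
  move=> u vu; have := ge u vu => vu_le; rewrite sub0r normrN ge_min.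
  by rewrite ler0_norm ?ger0_norm; [|lra|lra]; apply/orP; left; lra.
have [/existsP[u /andP[]]|/existsPn high] := boolP [exists u, G v u && (f v < f u)].
  by exists u.
have le u : G v u -> f u <= f v by move=> vu; have := high u; rewrite vu -leNgt.
have := @max_contrast_move _ _ _ _ _ _ v 1 2 g01 fmax fv _ _ w vw (far w).
have := le w vw => vw_le.
rewrite !ger0_norm; [|lra|lra].
move=> H; suff: 1 - f w <= f v - f w by lra.
apply: H; first by lra.
move=> u vu; have := le u vu => vu_le; rewrite ge_min.
by rewrite !ger0_norm; [|lra|lra]; apply/orP; left; lra.
Qed.

(** * The possible values *)

Theorem theorem5p3 (R : realType) (V : finType) (G : sgraph V)
    (Vc : {set V}) (g f : V -> R)
    (Gconn : connected_graph G)
    (Gchi : chromatic_number G = 2%N)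
    (Vc_neq0 : Vc != set0)
    (Vc_proper : Vc \proper [set: V])
    (g01 : {in Vc, forall v, g v = 0 \/ g v = 1})
    (g_proper : {in Vc &, forall u v, G u v -> g u <> g v})
    (fmax : max_contrast_greyscale G Vc g f) :
  forall v : V, f v \in [:: 0; 1 / 3; 1 / 2; 2 / 3; 1].
Proof.
have [[f01 _ _] _ _] := fmax.
have third u v : G u v -> 1 / 3 <= `|f u - f v|.
  move=> uv; rewrite leNgt; apply/negP => lt3.
  have [h [hgs hg h3]] := exists_third_contrast Gchi Vc_neq0 Vc_proper g01 g_proper.
  have := @max_contrast_leximin _ _ _ _ _ _ h (1 / 3) fmax hgs hg _ u v uv lt3.
  rewrite leNgt (lt_le_trans lt3 (h3 u v uv)) => H.
  by suff: false by []; apply: H => x y xy; rewrite ge_min h3 ?orbT.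
have gap u v : G u v -> f u < f v -> f u + 1 / 3 <= f v.
  by move=> uv fuv; have := third u v uv; rewrite ltr0_norm ?subr_lt0 //; lra.
have between := max_contrast_between Gconn g01 fmax.
move=> v; rewrite !inE.
have [->|fv0] := eqVneq (f v) 0; first by [].
have [->|fv1] := eqVneq (f v) 1; first by rewrite !orbT.
have fv : 0 < f v < 1 by rewrite !lt_def fv0 eq_sym fv1 /=; have := f01 v; lra.
have [[x vx fx] [y vy fy]] := between v fv.
have symG := adj_sym G.
have fxv := gap x v; have fvy := gap v y vy fy.
rewrite symG in fxv; have {}fxv := fxv vx fx.
have [/existsP[w /andP[vw fw]]|/existsPn no_w] :=
  boolP [exists w, G v w && (0 < f w < 1)].
  have [[x' wx' fx'] [y' wy' fy']] := between w fw.
  have fxw := gap x' w; rewrite symG in fxw; have {}fxw := fxw wx' fx'.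
  have fwy := gap w y' wy' fy'.
  have := f01 x; have := f01 y; have := f01 x'; have := f01 y' => *.
  (* The ascending path is [x], [v], [w], [y'] in the first case and [x'], [w], [v], [y] in the
     second; its three gaps of at least 1/3 fill the unit interval. Equality would contradict
     [third]. *)
  have [fvw|fwv|fvw] := ltgtP (f v) (f w).
  - have := gap v w vw fvw => ?; have -> : f v = 1 / 3 by lra.
    by rewrite eqxx !orbT.
  - have := gap w v; rewrite symG => /(_ vw fwv) ?; have -> : f v = 2 / 3 by lra.
    by rewrite eqxx !orbT.
  by have := third v w vw; rewrite fvw subrr normr0; lra.
have ends w : G v w -> f w = 0 \/ f w = 1.
  move=> vw; have := no_w w; rewrite vw /= negb_and -!leNgt; have := f01 w.
  by case/andP=> w0 w1 /orP[|] ?; [left|right]; lra.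
suff -> : f v = 1 / 2 by rewrite eqxx !orbT.
(* At 1/2 every contrast at [v] equals the threshold 1/2, so any contrast below 1/2 would strictly
   grow. *)
have half w : G v w -> `|f v - f w| < 1 / 2 -> `|1 / 2 - f w| <= `|f v - f w|.
  apply: max_contrast_move g01 fmax fv _ _ w; first lra.
  move=> u /ends[]->; rewrite ge_min; apply/orP; right.
    by rewrite ger0_norm; lra.
  by rewrite ler0_norm; lra.
have fx0 : f x = 0 by case: (ends x vx); lra.
have fy1 : f y = 1 by case: (ends y vy); lra.
(* The contrasts towards [x] and [y] are [f v] and [1 - f v], one of which is below 1/2 unless [f v]
   is 1/2. *)
have := half x vx; have := half y vy; rewrite fx0 fy1 !subr0.
rewrite ![`|_ - 1|]ler0_norm; [|lra|lra].
rewrite !ger0_norm; [|lra|lra].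
by have [?|?|//] := ltgtP (f v) (1 / 2); lra.
Qed.
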